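(* Let $G=(V_G,E_G)$ be a finite directed graph with positive integer vertex weights $w(v)$ $(v\in V_G)$ satisfying $w(s)+w(t)>w(u)$ for all $s,t,u\in V_G$, with a total preorder $\precsim_v$ on the incoming edges of each $v \in V_G$, and let $D$ be the associated rooted digraph. If the algorithm described in the context returns an edge set $A^*$, then $A^*$ is a popular arborescence in $D$.
   Context: Setting. $D=(V,E)$ with $V=V_G\cup\{r\}$ ($r$ a new root vertex) and $E=E_G\cup\{(r,v):v\in V_G\}$. For non-empty $X\subseteq V_G$, $\delta^-(X)\subseteq E$ is the set of edges of $D$ entering $X$, $\delta^-(v)=\delta^-(\{v\})$, and $E[X]$ is the set of edges of $E$ with both ends in $X$. Each $v\in V_G$ has a total preorder $\precsim_v$ (transitive, reflexive, total) on $\delta^-(v)$; $e\precsim_v f$ (also $f\succsim_v e$) means $f$ has at least the priority of $e$; $e\sim_v f$ means $e\precsim_v f$ and $f\precsim_v e$; $e\prec_v f$ (also $f\succ_v e$; ''$f$ dominates $e$'') means $e\precsim_v f$ but not $f\precsim_v e$. The edge $(r,v)$ is strictly least preferred: every edge of $E_G\cap\delta^-(v)$ dominates $(r,v)$. Popularity. An $r$-arborescence in $D$ is a spanning out-tree rooted at $r$ (identified with its edge set); $A(v)$ is the edge of $A$ entering $v$. For $r$-arborescences $A,A'$, let $\Delta_w(A,A')=\sum_{v:A(v)\succ_v A'(v)}w(v)-\sum_{v:A'(v)\succ_v A(v)}w(v)$. $A$ is more popular than $A'$ if $\Delta_w(A,A')>0$; $A$ is a popular arborescence if no $r$-arborescence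 is more popular than $A$. Safe edges. For $X\subseteq V_G$, an edge $(u,v)\in E[X]$ is safe in $X$ if (i) $(u,v)\succsim_v(u',v)$ for all $(u',v)\in E[X]$, and (ii) $(u,v)\succ_v(t,v)$ for all $(t,v)\in\delta^-(X)$. $S(X)$ is the set of safe edges in $X$. Algorithm. Step 1. For each $v\in V_G$: put $X_v^0=V_G$, $i=0$; while $v$ does not reach all vertices in $D_v^i=(X_v^i,S(X_v^i))$, let $X_v^{i+1}$ be the set of vertices reachable from $v$ in $D_v^i$ and increase $i$ by 1. At the end set $X_v=X_v^i$, $D_v=D_v^i=(X_v,S(X_v))$. Step 2. Let $\mathcal{X}=\{X_v:v\in V_G\}$ and let $\mathcal{X}'$ be the family of inclusion-wise maximal members of $\mathcal{X}$ (the family $\mathcal X$ is laminar, so the members of $\mathcal{X}'$ partition $V_G$). Put $E'=\emptyset$ and $D'=(\mathcal{X}'\cup\{r\},E')$. Step 3. For each $X_v\in\mathcal{X}'$: let $\bar X_v$ be the strongly connected component of $D_v$ that no edge of $S(X_v)$ enters. Say that a minimum-weight vertex $v'$ of $\bar X_v$ satisfies condition (C) if there exist $s\in X_v\setminus\bar X_v$ and $f\in(E[X_v]\setminus S(X_v))\cap\delta^-(v')$ such that: 1. $w(s)<w(v')$; 2. $v'$ is reachable from $s$ by edges in $S(X_v)\cup\{f\}$; 3. $f\succ_{v'}e$ for all $e\in\delta^-(v')\cap\delta^-(X_v)$. If every minimum-weight vertex of $\bar X_v$ satisfies (C), return ''No popular arborescence in $D$''. Otherwise, for every minimum-weight vertex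 $v'$ of $\bar X_v$ and every edge $e=(u,v')\in E$ with $u\notin X_v$ that is not dominated by any edge of $\delta^-(X_v)$, add to $E'$ an edge $e'$ corresponding to $e$, where $e'=(U,X_v)$ if $u\in U\in\mathcal{X}'$, and $e'=(r,X_v)$ if $u=r$ (distinct $e$ give distinct, possibly parallel, $e'$). Step 4. If $D'=(\mathcal{X}'\cup\{r\},E')$ contains no $r$-arborescence, return ''No popular arborescence in $D$''. Otherwise take an $r$-arborescence $A'$ in $D'$, let $\tilde A=\{e:e'\in A'\}$ and $R=\{v\in V_G:|X_v|\ge 2,\ \delta^-(v)\cap\tilde A\ne\emptyset\}$; for each $v\in R$ let $A_v$ be a $v$-arborescence (spanning out-tree rooted at $v$) in $(X_v,S(X_v))$; return $A^*=\tilde A\cup\bigcup_{v\in R}A_v$.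
   Formalization: In Step 3, edges are added to E' only for minimum-weight vertices v' of the source component that do not satisfy condition (C); with edges added for every minimum-weight vertex, as written, the returned set need not be popular. G is taken without loops. *)

(* Defs.v *)
From HB Require Import structures.
From mathcomp Require Import all_boot all_order all_algebra.

Set Implicit Arguments.
Unset Strict Implicit.
Unset Printing Implicit Defensive.

Import GRing.Theory Num.Theory.

Section Digraph.

Variables (T F : finType) (tl hd : F -> T).

Definition edge_rel (A : {set F}) : rel T :=
  [rel x y | [exists e in A, (tl e == x) && (hd e == y)]].

(* [A] is (the edge set of) a spanning out-tree, rooted at [r], of the digraph
   with vertex set [W] and edge set [B]. *)
Definition arborescence (W : {set T}) (B : {set F}) (r : T) (A : {set F}) :
    bool :=
  [&& r \in W,
      A \subset [set e in B | (tl e \in W) && (hd e \in W)],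
      [forall x in W, #|[set e in A | hd e == x]| == (x != r)]
    & [forall x in W, connect (edge_rel A) r x]].

End Digraph.

Section PopularArborescence.

Variables (VG EG : finType) (src tgt : EG -> VG).

(* The vertices of D are [option VG], the root being [None]; the edges of D are
   those of G ([inl]) together with one root edge (r, v) for each v ([inr v]).
   Edges are abstract, so parallel edges are allowed.  No edge enters the root,
   hence [head] takes its values in [VG]. *)
Definition edge : finType := (EG + VG)%type.

Definition tail (e : edge) : option VG :=
  if e is inl a then Some (src a) else None.

Definition head (e : edge) : VG :=
  match e with inl a => tgt a | inr v => v end.

Definition root_edge (v : VG) : edge := inr v.

Definition entering (X : {set VG}) : {set edge} :=
  [set e | (head e \in X) && (tail e \notin Some @: X)].

Definition inside (X : {set VG}) : {set edge} :=
  [set e | (head e \in X) && (tail e \in Some @: X)].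

Definition arborescence_in (X : {set VG}) (B : {set edge}) (v : VG) :
    {set edge} -> bool :=
  arborescence tail (Some \o head) (Some @: X) B (Some v).

Definition r_arborescence : {set edge} -> bool :=
  arborescence tail (Some \o head) [set: option VG] [set: edge] None.

Definition reach (B : {set edge}) (x y : VG) : bool :=
  connect (edge_rel tail (Some \o head) B) (Some x) (Some y).

Variable w : VG -> nat.

(* [le v e f] : [f] has at least the priority of [e] at [v]; it is only
   meaningful for [e] and [f] in [entering [set v]]. *)
Variable le : VG -> rel edge.

Definition lt (v : VG) (e f : edge) : bool := le v e f && ~~ le v f e.

Definition total_preorder_on (D : {set edge}) (R : rel edge) : Prop :=
  [/\ {in D, reflexive R}, {in D & &, transitive R} & {in D &, total R}].

(* The default value is never used when [A] is an arborescence. *)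
Definition edge_into (A : {set edge}) (v : VG) : edge :=
  odflt (root_edge v) [pick e in A :&: entering [set v]].

Definition Delta (A A' : {set edge}) : int :=
  ((\sum_(v | lt v (edge_into A' v) (edge_into A v)) (w v)%:Z)
   - (\sum_(v | lt v (edge_into A v) (edge_into A' v)) (w v)%:Z))%R.

Definition more_popular (A A' : {set edge}) : bool := (0 < Delta A A')%R.

Definition popular (A : {set edge}) : Prop :=
  r_arborescence A /\
  ~ (exists2 A' : {set edge}, r_arborescence A' & more_popular A' A).

Definition safe (X : {set VG}) : {set edge} :=
  [set e in inside X |
    [forall f in inside X, (head f == head e) ==> le (head e) f e] &&
    [forall f in entering X, (head f == head e) ==> lt (head e) f e]].

Definition shrink (v : VG) (X : {set VG}) : {set VG} :=
  if [forall x in X, reach (safe X) v x] then X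
  else [set x in X | reach (safe X) v x].

(* X_v : the loop that iterates [shrink v] from the full vertex set stops after
   at most [#|VG|] rounds, see [reach_Xset] below. *)
Definition Xset (v : VG) : {set VG} := iter #|VG| (shrink v) [set: VG].

Definition Xfamily : {set {set VG}} := [set Xset v | v : VG].

Definition Xmax : {set {set VG}} :=
  [set X | maxset (fun Y => Y \in Xfamily) X].

Definition sccs (X : {set VG}) : {set {set VG}} :=
  equivalence_partition
    [rel x y | reach (safe X) x y && reach (safe X) y x] X.

(* The strongly connected component of (X, safe X) that no safe edge enters; it
   exists and is unique when some vertex of [X] reaches all of [X]. *)
Definition source_scc (X : {set VG}) : {set VG} :=
  odflt set0 [pick C in sccs X | entering C :&: safe X == set0].

Definition min_weight (C : {set VG}) : {set VG} :=
  [set v in C | [forall u in C, w v <= w u]].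

Definition condC (X : {set VG}) (v : VG) : bool :=
  [exists s in X :\: source_scc X,
   exists f in (inside X :\: safe X) :&: entering [set v],
     [&& w s < w v,
         reach (f |: safe X) s v
       & [forall e in entering [set v] :&: entering X, lt v e f]]].

(* Vertices satisfying [condC] must be skipped even when another minimum-weight
   vertex of the same source component violates it.  Otherwise the output need
   not be popular: take w a = w b = 3, w s = 2 and the edges ab, ba, as, sa with
   ba preferred to sa; the edges ra, ab, as would form a possible output, but
   rs, sa, ab is more popular. *)
Definition entry_vertices (X : {set VG}) : {set VG} :=
  [set v in min_weight (source_scc X) | ~~ condC X v].

(* An edge of D' is represented by the edge of D it corresponds to; only its
   ends change.  The root of D' is [None]. *)
Definition contracted_edges : {set edge} :=
  [set e | [exists X in Xmax,
     [&& head e \in entry_vertices X, tail e \notin Some @: X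
       & [forall f in entering X,
            (head f == head e) ==> ~~ lt (head e) e f]]]].

Definition contracted_tail (e : edge) : option {set VG} :=
  omap (pblock Xmax) (tail e).

Definition contracted_head (e : edge) : option {set VG} :=
  Some (pblock Xmax (head e)).

Definition contracted_arborescence : {set edge} -> bool :=
  arborescence contracted_tail contracted_head
    (None |: (Some @: Xmax)) contracted_edges None.

Definition expanded (A : {set edge}) : {set VG} :=
  [set v | (1 < #|Xset v|) && (entering [set v] :&: A != set0)].

Definition step3_fails : bool :=
  [exists X in Xmax, [forall v in min_weight (source_scc X), condC X v]].

(* The possible outcomes of the algorithm, for all choices of the arborescences
   it picks; [None] is the answer "No popular arborescence in D". *)
Inductive algorithm_output : option {set edge} -> Prop :=
| No_step3 of step3_fails : algorithm_output None
| No_step4 of ~~ step3_fails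
    & ~ (exists A : {set edge}, contracted_arborescence A) :
    algorithm_output None
| Output (At : {set edge}) (Av : VG -> {set edge}) of ~~ step3_fails
    & contracted_arborescence At
    & (forall v, v \in expanded At ->
         arborescence_in (Xset v) (safe (Xset v)) v (Av v)) :
    algorithm_output (Some (At :|: \bigcup_(v in expanded At) Av v)).

Lemma reach_Xset v x : x \in Xset v -> reach (safe (Xset v)) v x.
Proof.
pose done_ (X : {set VG}) := [forall x in X, reach (safe X) v x].
pose X k := iter k (shrink v) [set: VG].
have shrinkE k : X k.+1 = if done_ (X k) then X k
    else [set x in X k | reach (safe (X k)) v x] by [].
have vX k : v \in X k.
  elim: k => [|k IH]; first by rewrite inE.
  by rewrite shrinkE; case: ifP => // _; rewrite inE IH /reach connect0.
have loop k : done_ (X k) || (#|X k| + k <= #|VG|).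
  elim: k => [|k IH]; first by rewrite addn0 max_card orbT.
  rewrite shrinkE; case: ifP => [-> //|notdone]; rewrite notdone /= in IH.
  apply/orP; right; rewrite addnS; apply: leq_trans IH; rewrite ltn_add2r.
  apply: proper_card; apply/properP; split.
    by apply/subsetP => y; rewrite inE => /andP[].
  move/negbT: notdone; rewrite negb_forall => /existsP[y].
  by rewrite negb_imply => /andP[yX nry]; exists y; rewrite // inE yX.
have /orP[/forall_inP|] := loop #|VG|; first exact.
by rewrite -[leqRHS]add0n leq_add2r leqn0 => /eqP/card0_eq/(_ v); rewrite vX.
Qed.

End PopularArborescence.

(* Main.v *)
Require Import Defs.
From mathcomp Require Import all_boot all_order all_algebra.

(** The maximal sets [X_v] partition the vertices, and it suffices to compare
    the output [A] with a rival [A'] on one block [X] at a time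
    ([blockwise_sum], [block_loss_ge_gain]).

    The output is an arborescence that enters each block [X] exactly once, at a
    minimum-weight vertex [u] of the source component that violates [condC],
    through an edge that no other edge entering [X] at [u] dominates; every
    other vertex of [X] gets a safe edge ([output_arborescence],
    [output_safe]).  By the definition of safety [A'] cannot beat a safe edge,
    so the only vertex of [X] at which [A'] may win is [u], and then [A'] enters
    [u] by an edge from inside [X].  Since [A'] must nevertheless enter [X]
    somewhere, say at [s], it loses there.  The rival thus gains [w u] and
    loses at least [w s].

    If [A'] loses at a second vertex of [X], the triangle inequality on weights
    settles the comparison, as does [w u <= w s].  Otherwise [s] lies outside
    the source component, in which [u] has minimum weight; the edges of [A']
    into the vertices of [X] other than [s] and [u] come from inside [X] and tie
    with safe edges, so they are safe; and the path of [A'] from [s] to [u]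
    shows that [u] satisfies [condC] ([single_loss_condC]), a contradiction.

    That the maximal [X_v] are disjoint rests on laminarity ([Xset_laminar]):
    [X_v] is the largest set that [v] spans by its safe edges ([Xset_sup]),
    and two such sets that overlap without containing each other's origin would
    give a vertex two incoming edges, one dominating the other although its
    priority is no higher.  *)

(** * Directed cuts and arborescences *)

Section Crossing.

Set Implicit Arguments.
Unset Strict Implicit.

Variables (T F : finType) (tl hd : F -> T).

Lemma edge_relP (A : {set F}) x y :
  reflect (exists2 e, e \in A & tl e = x /\ hd e = y) (edge_rel tl hd A x y).
Proof.
apply: (iffP exists_inP) => -[e eA].
  by case/andP=> /eqP tle /eqP hde; exists e.
by case=> <- <-; exists e; rewrite // !eqxx.
Qed.

Lemma connect_edge (A : {set F}) e :
  e \in A -> connect (edge_rel tl hd A) (tl e) (hd e).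
Proof. by move=> eA; apply/connect1/edge_relP; exists e. Qed.

Lemma connect_edge_relS (A B : {set F}) x y :
  A \subset B -> connect (edge_rel tl hd A) x y ->
  connect (edge_rel tl hd B) x y.
Proof.
move=> sAB; apply: connect_sub => a b /edge_relP[e eA [<- <-]].
exact/connect_edge/(subsetP sAB).
Qed.

(** This replaces inductions along paths: to see that a set of bad vertices is
    unreachable, it suffices to look at one edge entering it.  With [Z] a
    singleton it gives the last edge of a path. *)
Lemma connect_crossing (A : {set F}) (Z : {pred T}) x y :
  connect (edge_rel tl hd A) x y -> x \notin Z -> y \in Z ->
  exists2 e, e \in A & (tl e \notin Z) && (hd e \in Z).
Proof.
move=> /connectP[p + ->]; elim: p x => [|a p IH] x /=; first by move=> _ /negP.
case/andP=> /edge_relP[e eA [tle hde]] ap xZ lZ.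
have [aZ|/IH] := boolP (a \in Z); last exact.
by exists e; rewrite // tle hde xZ.
Qed.

Lemma arborescence_in_edge W B r (A : {set F}) x :
    arborescence tl hd W B r A -> x \in W -> x != r ->
  exists2 e, e \in A & hd e = x /\ forall f, f \in A -> hd f = x -> f = e.
Proof.
case/and4P=> _ _ /forall_inP inA _ /inA /[swap] -> /cards1P[e eE].
have := set11 e; rewrite -eE inE => /andP[eA /eqP hde].
exists e => //; split=> // f fA hdf; apply/set1P.
by rewrite -eE inE fA hdf eqxx.
Qed.

Lemma arborescence_root W B r (A : {set F}) e :
  arborescence tl hd W B r A -> e \in A -> hd e != r.
Proof.
case/and4P=> rW _ /forall_inP/(_ _ rW); rewrite eqxx cards_eq0 => /eqP A0 _ eA.
by apply/eqP => her; have := in_set0 e; rewrite -A0 inE eA her eqxx.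
Qed.

Lemma arborescence_sub W B r (A : {set F}) e :
  arborescence tl hd W B r A -> e \in A -> e \in B.
Proof.
by case/and4P=> _ /subsetP sAB _ _ /sAB; rewrite inE => /and3P[].
Qed.

Lemma arborescence_connect W B r (A : {set F}) x :
  arborescence tl hd W B r A -> x \in W -> connect (edge_rel tl hd A) r x.
Proof. by case/and4P=> _ _ _ /forall_inP; apply. Qed.

End Crossing.

(** * Priorities and safe edges *)

Section Algorithm.

Set Implicit Arguments.
Unset Strict Implicit.

Variables (VG EG : finType) (src tgt : EG -> VG).
Hypothesis loopless : forall a : EG, src a <> tgt a.
Variable w : VG -> nat.
Variable le : VG -> rel (edge VG EG).
Hypothesis le_preorder : forall v : VG,
  total_preorder_on (entering src tgt [set v]) (le v).

Local Notation edge := (edge VG EG).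
Local Notation tail := (tail src).
Local Notation head := (Defs.head tgt).
Local Notation entering := (entering src tgt).
Local Notation inside := (inside src tgt).
Local Notation safe := (safe src tgt le).
Local Notation reach := (reach src tgt).
Local Notation lt := (lt le).
Local Notation Xset := (Xset src tgt le).
Local Notation Xmax := (Xmax src tgt le).
Local Notation source_scc := (source_scc src tgt le).
Local Notation entry_vertices := (entry_vertices src tgt w le).
Local Notation condC := (condC src tgt w le).
Local Notation edge_into := (edge_into src tgt).
Local Notation r_arborescence := (r_arborescence src tgt).

Implicit Types (e f g : edge) (u v x y s t : VG) (X Y Z : {set VG}).

Lemma mem_Some (X : {set VG}) x : (Some x \in Some @: X) = (x \in X).
Proof. exact: mem_imset Some_inj. Qed.

Lemma tail_neq_head e : tail e != Some (head e).
Proof.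
by case: e => [a|v] //=; apply/eqP => -[] /loopless.
Qed.

(** Without loops, the domain on which priorities are meaningful is
    described by heads alone. *)
Lemma mem_entering1 e v : (e \in entering [set v]) = (head e == v).
Proof.
rewrite !inE; apply: andb_idr => /eqP <-.
by rewrite imset_set1 inE tail_neq_head.
Qed.

Lemma le_trans f v e g : head e = v -> head f = v -> head g = v ->
  le v e f -> le v f g -> le v e g.
Proof.
move=> he hf hg; have [_ + _] := le_preorder v.
by apply; rewrite mem_entering1 ?he ?hf ?hg.
Qed.

Lemma le_total v e f : head e = v -> head f = v -> le v e f || le v f e.
Proof.
move=> he hf; have [_ _ +] := le_preorder v.
by apply; rewrite mem_entering1 ?he ?hf.
Qed.

Lemma lt_le_trans f v e g : head e = v -> head f = v -> head g = v ->
  lt v e f -> le v f g -> lt v e g.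
Proof.
move=> he hf hg /andP[ef nfe] fg; rewrite /Defs.lt (le_trans he hf hg) //=.
by apply: contra nfe; apply: le_trans.
Qed.

Lemma le_lt_trans f v e g : head e = v -> head f = v -> head g = v ->
  le v e f -> lt v f g -> lt v e g.
Proof.
move=> he hf hg ef /andP[fg ngf]; rewrite /Defs.lt (le_trans he hf hg) //=.
by apply: contra ngf => ge; apply: le_trans ef.
Qed.

Lemma nlt_le v e f : head e = v -> head f = v -> ~~ lt v e f -> le v f e.
Proof.
move=> he hf; rewrite negb_and negbK => /orP[nef|//].
by have:= le_total he hf; rewrite (negPf nef).
Qed.

Lemma safeP X e :
  reflect [/\ e \in inside X, forall f, head f = head e -> le (head e) f e
            & forall f, head f = head e -> tail f \notin Some @: X ->
                lt (head e) f e]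
          (e \in safe X).
Proof.
apply: (iffP idP) => [|[eX eI eO]].
  rewrite inE => /and3P[eX /forall_inP eI /forall_inP eO].
  have hX : head e \in X by move: eX; rewrite inE => /andP[].
  have eO' f : head f = head e -> tail f \notin Some @: X -> lt (head e) f e.
    move=> hf tf; apply: (implyP (eO f _)); last exact/eqP.
    by rewrite inE hf hX.
  split=> // f hf; have [tf|tf] := boolP (tail f \in Some @: X).
    by apply: (implyP (eI f _)); [rewrite inE hf hX | exact/eqP].
  by have /andP[] := eO' f hf tf.
rewrite inE eX /=; apply/andP; split; apply/forall_inP => f fX;
  apply/implyP => /eqP hf; first exact: eI.
by apply: eO; move: fX; rewrite // inE => /andP[].
Qed.

Lemma safe_inside X e :
  e \in safe X -> head e \in X /\ tail e \in Some @: X.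
Proof. by case/safeP=> + _ _; rewrite inE => /andP[]. Qed.

(** An edge with head in [Y] that lies inside [X] is either inside [Y] or enters
    [Y], and a safe edge of [Y] is at least as good as both. *)
Lemma safeS X Y : Y \subset X -> safe Y \subset safe X.
Proof.
move=> sYX; apply/subsetP => e /safeP[eY eI eO].
have sS : Some @: Y \subset Some @: X := imsetS Some sYX.
apply/safeP; split=> // [|f hf tf].
  move: eY; rewrite !inE => /andP[hY tY].
  by rewrite (subsetP sYX) // (subsetP sS).
by apply: eO => //; apply: contra tf; apply: (subsetP sS).
Qed.

Lemma reach_trans (B : {set edge}) y x z :
  reach B x y -> reach B y z -> reach B x z.
Proof. exact: connect_trans. Qed.

Lemma reachS (B C : {set edge}) x y : B \subset C -> reach B x y -> reach C x y.
Proof. exact: connect_edge_relS. Qed.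

(** * The laminar family of the sets X_v *)

(** [safeS] makes [Y] survive every round of the loop.  As [v] spans [X_v]
    itself, [X_v] is the largest set with this property. *)
Lemma Xset_sup v Y : {in Y, forall x, reach (safe Y) v x} -> Y \subset Xset v.
Proof.
move=> vY; rewrite /Defs.Xset; elim: #|VG| => [|n IH] /=.
  by apply/subsetP => x; rewrite inE.
rewrite {1}/shrink; case: ifP => // _; apply/subsetP => x xY.
by rewrite inE (subsetP IH) //= (reachS (safeS IH)) ?vY.
Qed.

Lemma mem_Xset v : v \in Xset v.
Proof.
rewrite -sub1set; apply: Xset_sup => x /set1P->; exact: connect0.
Qed.

(** Here [v] reaches [u], and [u] reaches all of [X_u], so [v] spans the union
    of [X_u] and [X_v]. *)
Lemma Xset_sub u v : u \in Xset v -> Xset u \subset Xset v.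
Proof.
move=> uv; apply: subset_trans (subsetUl _ (Xset v)) _.
have sl := safeS (subsetUl (Xset u) (Xset v)).
have sr := safeS (subsetUr (Xset u) (Xset v)).
apply: Xset_sup => x /setUP[xu|xv]; last exact/(reachS sr)/reach_Xset.
exact: reach_trans (reachS sr (reach_Xset uv)) (reachS sl (reach_Xset xu)).
Qed.

(** If neither set contains the origin of the other, the path of safe edges from
    [u] to [x] enters [X_v] by an edge [e], and [v] reaches the head of [e] by
    an edge [f] safe in [X_v].  Safety of [f] makes it dominate the entering
    edge [e], against the safety of [e] in [X_u]. *)
Lemma Xset_laminar u v x : x \in Xset u -> x \in Xset v ->
  Xset u \subset Xset v \/ Xset v \subset Xset u.
Proof.
move=> xu xv; have [/Xset_sub|uNv] := boolP (u \in Xset v); first by left.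
have [/Xset_sub|vNu] := boolP (v \in Xset u); first by right.
have [||e eS /andP[te he]] :=
  connect_crossing (Z := mem (Some @: Xset v)) (reach_Xset xu).
- by rewrite mem_Some.
- by rewrite mem_Some.
rewrite /= mem_Some in he.
have [heu _] := safe_inside eS.
have vNh : Some v != Some (head e) by apply: contraNneq vNu => -[->].
have [||f fS /andP[_ /eqP[hf]]] :=
  connect_crossing (Z := pred1 (Some (head e))) (reach_Xset he).
- by [].
- by rewrite inE.
have [_ eI _] := safeP _ _ eS; have [_ _ fO] := safeP _ _ fS.
have := fO _ (esym hf) te; rewrite hf.
by case/andP=> _ /negP[]; apply: eI.
Qed.

Lemma XmaxP X : X \in Xmax ->
  exists2 u, X = Xset u & forall v, X \subset Xset v -> Xset v = X.
Proof.
rewrite inE => /maxsetP[/imsetP[u _ XE] Xsup]; exists u => // v sXv.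
by apply: Xsup => //; apply: imset_f.
Qed.

Lemma Xmax_inj X Y x : X \in Xmax -> Y \in Xmax -> x \in X -> x \in Y -> X = Y.
Proof.
move=> /XmaxP[u Xu supX] /XmaxP[v Yv supY] xX xY.
rewrite Xu in xX; rewrite Yv in xY.
have [sXY|sYX] := Xset_laminar xX xY.
  by rewrite Yv; apply/esym/supX; rewrite Xu.
by rewrite Xu; apply/supY; rewrite Yv.
Qed.

Lemma trivIset_Xmax : trivIset Xmax.
Proof.
apply/trivIsetP => X Y XM YM; apply: contraNT => /pred0Pn[x /andP[xX xY]].
exact/eqP/(Xmax_inj XM YM xX xY).
Qed.

Lemma pblock_XmaxE X x : X \in Xmax -> x \in X -> pblock Xmax x = X.
Proof. exact: def_pblock trivIset_Xmax. Qed.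

Lemma pblock_XmaxP x : pblock Xmax x \in Xmax /\ x \in pblock Xmax x.
Proof.
have xF : Xset x \in Xfamily src tgt le by apply: imset_f.
have [X XM sX] := maxset_exists xF.
have XM' : X \in Xmax by rewrite inE.
have xX : x \in X by rewrite (subsetP sX) ?mem_Xset.
by rewrite (pblock_XmaxE XM').
Qed.

(** The origin of [X] reaches everything and no safe edge enters the source
    component, so the latter contains the origin. *)
Lemma source_sccP X v : X \in Xmax -> v \in source_scc X ->
  [/\ v \in X, {in X, forall s, reach (safe X) v s}
    & {in X, forall s, reach (safe X) s v -> s \in source_scc X}].
Proof.
case/XmaxP=> u Xu _; rewrite /Defs.source_scc; case: pickP => [C|_]; last first.
  by rewrite inE.
case/andP=> /imsetP[x xX CE] /eqP noin; rewrite /= => vC.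
have [vX xv vx] : [/\ v \in X, reach (safe X) x v & reach (safe X) v x].
  by move: vC; rewrite CE inE => /and3P[].
have uX : u \in X by rewrite Xu mem_Xset.
have uall s : s \in X -> reach (safe X) u s by rewrite Xu; apply: reach_Xset.
have uC : u \in C.
  apply: contraT => uNC.
  have [||e eS /andP[te he]] :=
    connect_crossing (Z := mem (Some @: C)) (uall _ vX).
  - by rewrite mem_Some.
  - by rewrite mem_Some.
  rewrite -(in_set0 e) -noin in_setI eS andbT inE te andbT.
  by rewrite /= mem_Some in he.
have vu : reach (safe X) v u.
  move: uC; rewrite CE inE => /and3P[_ xu _]; exact: reach_trans vx xu.
split=> // [s sX|s sX sv]; first exact: reach_trans (uall s sX).
rewrite CE inE sX /= (reach_trans sv vx) andbT.
by apply: reach_trans xv _; apply: reach_trans vu (uall s sX).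
Qed.

(** A vertex of the source component spans all of [X], hence [X_v] contains [X]
    and equals it by maximality. *)
Lemma entry_verticesP X v : X \in Xmax -> v \in entry_vertices X ->
  [/\ v \in X, Xset v = X, v \in source_scc X,
      {in source_scc X, forall u, w v <= w u} & ~~ condC X v].
Proof.
move=> XM; rewrite !inE => /andP[/andP[vC /forall_inP vmin] nC].
have [vX vall _] := source_sccP XM vC.
split=> //; have [u _ Xsup] := XmaxP XM.
exact/Xsup/Xset_sup.
Qed.

Lemma edge_intoP A v : r_arborescence A ->
  [/\ edge_into A v \in A, head (edge_into A v) = v
    & forall e, e \in A -> head e = v -> e = edge_into A v].
Proof.
move=> arbA.
have [//|e eA [[he] eU]] := arborescence_in_edge arbA (in_setT (Some v)).
have -> : edge_into A v = e.
  rewrite /Defs.edge_into; case: pickP => [f|/(_ e)] /=.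
    rewrite inE mem_entering1 => /andP[fA /eqP hf].
    by apply: eU => //=; rewrite hf.
  by rewrite inE mem_entering1 eA he eqxx.
by split=> // f fA hf; apply: eU => //=; rewrite hf.
Qed.

(** * The output is an arborescence *)

Section Output.

Variables (At : {set edge}) (Av : VG -> {set edge}).
Hypothesis At_arb : contracted_arborescence src tgt w le At.
Hypothesis Av_arb : forall v, v \in expanded src tgt le At ->
  arborescence_in src tgt (Xset v) (safe (Xset v)) v (Av v).

Let A := At :|: \bigcup_(v in expanded src tgt le At) Av v.

Lemma At_edge e : e \in At ->
  exists2 X, X \in Xmax &
    head e \in entry_vertices X /\
    (forall f, f \in entering X -> head f = head e -> ~~ lt (head e) e f).
Proof.
move=> eA; have := arborescence_sub At_arb eA.
rewrite inE => /exists_inP[X XM /and3P[hX _ /forall_inP eU]].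
by exists X => //; split=> // f fX /eqP; apply/implyP/eU.
Qed.

Lemma expandedP v : v \in expanded src tgt le At ->
  Xset v \in Xmax /\ (exists2 e, e \in At & head e = v).
Proof.
rewrite inE => /andP[_ /set0Pn[e]]; rewrite inE mem_entering1.
case/andP=> /eqP hev eA; have [X XM [hX _]] := At_edge eA.
have [_ XE _ _ _] := entry_verticesP XM hX.
by split=> //; [rewrite -hev XE | exists e].
Qed.

Lemma At_entry X : X \in Xmax ->
  exists2 e, e \in At &
    [/\ head e \in entry_vertices X,
        forall f, f \in entering X -> head f = head e -> ~~ lt (head e) e f
      & forall f, f \in At -> head f \in X -> f = e].
Proof.
move=> XM.
have XN : Some X \in None |: (Some @: Xmax).
  by rewrite !inE /= (mem_imset _ _ Some_inj).
have [//|e eA [[hX] eU]] := arborescence_in_edge At_arb XN.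
have [Y YM [hY domY]] := At_edge eA.
have [hY' _ _ _ _] := entry_verticesP YM hY.
have YX : Y = X by rewrite -hX (pblock_XmaxE YM hY').
rewrite YX in hY domY; exists e => //; split=> // f fA hf.
by apply: eU; rewrite // /contracted_head (pblock_XmaxE XM hf).
Qed.

Lemma mem_expanded e X v : e \in At -> head e \in entry_vertices X ->
  X \in Xmax -> v \in X -> v != head e -> head e \in expanded src tgt le At.
Proof.
move=> eA hX XM vX vNe; have [hX' XE _ _ _] := entry_verticesP XM hX.
rewrite inE XE; apply/andP; split.
  rewrite (cardsD1 (head e)) hX' ltnS card_gt0.
  by apply/set0Pn; exists v; rewrite !inE vNe.
by apply/set0Pn; exists e; rewrite inE mem_entering1 eA eqxx.
Qed.

(** Blocks do not interfere: the arborescence expanding one block has no edges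
    into another, since all its edges are safe in its own block. *)
Lemma output_edgeP e f X : X \in Xmax -> e \in At -> head e \in X ->
    f \in A -> head f \in X ->
  f = e \/
  [/\ head e \in expanded src tgt le At, f \in Av (head e) & f \in safe X].
Proof.
move=> XM eA hX /setUP[fA|/bigcupP[u uE fu]] hfX.
  have [g _ [_ _ gU]] := At_entry XM; left.
  by rewrite (gU _ fA hfX) (gU _ eA hX).
right; have [uM [g gA hg]] := expandedP uE.
have fS := arborescence_sub (Av_arb uE) fu.
have [hfu _] := safe_inside fS.
have XE : X = Xset u := Xmax_inj XM uM hfX hfu.
have [k _ [_ _ kU]] := At_entry XM.
have hgX : head g \in X by rewrite hg XE mem_Xset.
have ge : g = e by rewrite (kU _ gA hgX) (kU _ eA hX).
by rewrite -ge hg; split=> //; rewrite XE.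
Qed.

(** Reachability is lifted along the contracted arborescence: call a block bad
    if some vertex of it is missed.  An edge from the root or a good block to
    a block [X] reaches an entry vertex of [X], and the expansion of [X] does
    the rest, so [X] is good as well. *)
Lemma output_connect v : connect (edge_rel tail (Some \o head) A) None (Some v).
Proof.
set R := connect _.
have sAt : At \subset A := subsetUl _ _.
pose bad := [pred z : option {set VG} |
  if z is Some X then ~~ [forall x in X, R None (Some x)] else false].
suff good X : X \in Xmax -> Some X \notin bad.
  have [vM vX] := pblock_XmaxP v.
  by have := good _ vM; rewrite negbK => /forall_inP; apply.
move=> XM; apply/negP => Xbad.
have XN : Some X \in None |: (Some @: Xmax).
  by rewrite !inE /= (mem_imset _ _ Some_inj).
have [//|//|e eA /andP[te he]] :=
  connect_crossing (Z := bad) (arborescence_connect At_arb XN).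
case/negP: he; rewrite {X XM Xbad XN}.
have [X XM [hX _]] := At_edge eA.
have [hX' XE _ _ _] := entry_verticesP XM hX.
have reach_head : R None (Some (head e)).
  apply: (@connect_trans _ _ (tail e)); last first.
    exact: (@connect_edge _ _ _ (Some \o head) A e (subsetP sAt e eA)).
  case tE: (tail e) te => [t|] /=; last by rewrite connect0.
  rewrite /contracted_tail tE negbK => /forall_inP; apply.
  by case: (pblock_XmaxP t).
rewrite (pblock_XmaxE XM hX'); apply/forall_inP => x xX.
have [->//|xNe] := eqVneq x (head e).
have eE := mem_expanded eA hX XM xX xNe.
apply: connect_trans reach_head _.
have xX' : Some x \in Some @: Xset (head e) by rewrite mem_Some XE.
apply: connect_edge_relS (arborescence_connect (Av_arb eE) xX').
by apply/subsetP => f fe; apply/setUP; right; apply/bigcupP; exists (head e).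
Qed.

Lemma output_arborescence : r_arborescence A.
Proof.
apply/and4P; split.
- by rewrite inE.
- by apply/subsetP => e _; rewrite !inE.
- apply/forall_inP => -[v|] _; last first.
    by rewrite /= cards_eq0; apply/eqP/setP => e; rewrite !inE andbF.
  have [XM vX] := pblock_XmaxP v; set X := pblock _ v in XM vX.
  have [e eA [hX _ _]] := At_entry XM.
  have [hX' XE _ _ _] := entry_verticesP XM hX.
  suff [g gA [hg gU]] :
      exists2 g, g \in A & head g = v /\
        forall f, f \in A -> head f = v -> f = g.
    apply/cards1P; exists g; apply/setP => f; rewrite !inE; apply/andP/eqP.
      by move=> [fA /eqP[hf]]; apply: gU; rewrite // !inE.
    by move=> ->; rewrite /= hg eqxx; split=> //; rewrite -in_setU.
  have [vE|vNe] := eqVneq v (head e).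
    exists e; first by apply/setUP; left.
    split=> // f fA hf; have hfX : head f \in X by rewrite hf.
    have [//|[eE fe _]] := output_edgeP XM eA hX' fA hfX.
    by have := arborescence_root (Av_arb eE) fe; rewrite /= hf vE eqxx.
  have eE := mem_expanded eA hX XM vX vNe.
  have vX' : Some v \in Some @: Xset (head e) by rewrite mem_Some XE.
  have [|g ge [[hg] gU]] := arborescence_in_edge (Av_arb eE) vX'.
    by apply: contra vNe => /eqP[->].
  exists g; first by apply/setUP; right; apply/bigcupP; exists (head e).
  split=> // f fA hf; have hfX : head f \in X by rewrite hf.
  have [fe|[_ fe _]] := output_edgeP XM eA hX' fA hfX.
    by rewrite -hf fe eqxx in vNe.
  by apply: gU; rewrite //= hf.
- apply/forall_inP => -[v|] _; [exact: output_connect | exact: connect0].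
Qed.

Lemma output_safe X : X \in Xmax ->
  exists2 u, u \in entry_vertices X &
    (forall f, f \in entering X -> head f = u -> le u f (edge_into A u)) /\
    ({in X, forall v, v != u -> edge_into A v \in safe X}).
Proof.
move=> XM; have [e eA [hX dom _]] := At_entry XM.
have [hX' _ _ _ _] := entry_verticesP XM hX.
have inA v := edge_intoP v output_arborescence.
exists (head e) => //; have <- : e = edge_into A (head e).
  by have [_ _] := inA (head e); apply; rewrite // inE eA.
split=> // [f fX hf|v vX vNe].
  exact/nlt_le/dom.
have [gA hg _] := inA v; have hgX : head (edge_into A v) \in X by rewrite hg.
have [ge|[]//] := output_edgeP XM eA hX' gA hgX.
by rewrite -hg ge eqxx in vNe.
Qed.

End Output.

(** * Comparison with a rival on one block *)

(** Here [a v] stands for the edge of the output entering [v]; the hypotheses on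
    [u] and [a] are the conclusions of [output_safe] for the block [X]. *)
Section Comparison.

Hypothesis w_triangle : forall s t u : VG, w u < w s + w t.
Variables (a : VG -> edge) (A' : {set edge}) (X : {set VG}) (u : VG).
Hypothesis A'_arb : r_arborescence A'.
Hypothesis head_a : forall v, head (a v) = v.
Hypothesis XM : X \in Xmax.
Hypothesis uX : u \in entry_vertices X.
Hypothesis u_dom : forall f, f \in entering X -> head f = u -> le u f (a u).
Hypothesis a_safe : {in X, forall v, v != u -> a v \in safe X}.

Local Notation a' := (edge_into A').
Let loss v := lt v (a' v) (a v).

Lemma gain_at_entry v : v \in X -> lt v (a v) (a' v) -> v = u.
Proof.
move=> vX /andP[_]; apply: contraNeq => vNu.
have [_ aI _] := safeP _ _ (a_safe vX vNu).
by have [_ ha' _] := edge_intoP v A'_arb; rewrite head_a in aI; apply: aI.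
Qed.

(** Outside [u] the rival loses because safe edges dominate entering ones; at
    [u] itself it cannot both win and use an entering edge, as [a u] is
    undominated among those. *)
Lemma entering_loss f : lt u (a u) (a' u) -> f \in A' -> f \in entering X ->
  loss (head f) && (head f != u).
Proof.
move=> gain fA fX; have [_ _ /(_ f fA erefl) fE] := edge_intoP (head f) A'_arb.
have [hX tX] : head f \in X /\ tail f \notin Some @: X.
  by move: fX; rewrite inE => /andP.
have hNu : head f != u.
  apply: contraTneq gain => hu; rewrite -hu -fE hu.
  by rewrite /Defs.lt (u_dom fX hu) andbF.
rewrite hNu andbT /loss -fE.
have [_ _ aO] := safeP _ _ (a_safe hX hNu).
by rewrite head_a in aO; apply: aO.
Qed.

(** Not losing to the safe edge [a v] means being at least as good as it, and
    then safety carries over. *)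
Lemma no_loss_safe v : v \in X -> v != u -> ~~ loss v ->
  tail (a' v) \in Some @: X -> a' v \in safe X.
Proof.
move=> vX vNu nl ta'; have [_ ha' _] := edge_intoP v A'_arb.
have [_ aI aO] := safeP _ _ (a_safe vX vNu); rewrite head_a in aI aO.
have aa' : le v (a v) (a' v) := nlt_le ha' (head_a v) nl.
apply/safeP; rewrite ha'; split=> [|f hf|f hf tf].
- by rewrite inE ha' vX.
- by apply: (le_trans _ (head_a v)) aa' => //; apply: aI.
- by apply: (lt_le_trans _ (head_a v)) aa' => //; apply: aO.
Qed.

(** With [s] the only loss, [A'] enters [X] only at [s], so its path to [u]
    stays in [X] after [s] and uses safe edges and [a' u] only.  Moreover [a' u]
    is not safe: otherwise [s] would reach the source component by safe edges
    and belong to it, where no vertex is lighter than [u]. *)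
Lemma single_loss_condC s : lt u (a u) (a' u) -> w s < w u ->
  s \in X -> (forall t, t \in X -> loss t -> t = s) -> condC X u.
Proof.
move=> gain ws sX only.
have [uX' _ uC umin _] := entry_verticesP XM uX.
have [_ uall uback] := source_sccP XM uC.
have sNC : s \notin source_scc X.
  by apply: contraTN ws => /umin; rewrite -leqNgt.
have [a'A ha' _] := edge_intoP u A'_arb.
have inner f : f \in A' -> head f \in X -> head f != s -> tail f \in Some @: X.
  move=> fA hX; apply: contraNT => tX.
  have fX : f \in entering X by rewrite inE hX.
  have /andP[lf _] := entering_loss gain fA fX.
  exact/eqP/only.
have su : u != s by apply: contraTneq ws => ->; rewrite ltnn.
have reach_u : reach (a' u |: safe X) s u.
  apply: contraT => nsu.
  pose bad := [pred z : option VG |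
    (z \in Some @: X) && ~~ connect (edge_rel tail (Some \o head)
                                       (a' u |: safe X)) (Some s) z].
  have [||f fA /andP[te he]] := connect_crossing (Z := bad)
    (arborescence_connect (x := Some u) A'_arb (in_setT _)).
  - by apply/negP => /andP[/imsetP[]].
  - by apply/andP; rewrite mem_Some.
  case/andP: he; rewrite /= mem_Some => hX nsh.
  have hNs : head f != s.
    by apply: contraNneq nsh => ->; apply: connect0.
  have tX := inner f fA hX hNs.
  move: te; rewrite inE tX /= negbK => st.
  have [_ _ /(_ f fA erefl) fE] := edge_intoP (head f) A'_arb.
  case/negP: nsh; apply: connect_trans st _.
  apply: (@connect_edge _ _ _ (Some \o head)); rewrite inE.
  have [hu|hNu] := eqVneq (head f) u; first by rewrite -hu -fE set11.
  apply/orP; right; rewrite fE; apply: no_loss_safe => //; last by rewrite -fE.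
  by apply: contra hNs => /only ->.
have a'X : a' u \in inside X.
  by rewrite inE ha' uX' inner ?ha'.
apply/exists_inP; exists s; first by rewrite inE sNC.
apply/exists_inP; exists (a' u).
  rewrite inE mem_entering1 ha' eqxx andbT inE a'X andbT.
  apply: contra sNC => fS; apply: uback => //.
  by apply: reachS reach_u; rewrite subUset sub1set fS subxx.
apply/and3P; split=> //; apply/forall_inP => e.
rewrite inE mem_entering1 => /andP[/eqP he eX].
exact: (le_lt_trans he (head_a u) ha' (u_dom eX he)).
Qed.

Lemma block_loss_ge_gain :
  \sum_(v in X | lt v (a v) (a' v)) w v <= \sum_(v in X | loss v) w v.
Proof.
have [uX' _ _ _ nC] := entry_verticesP XM uX.
have [gain|nogain] := boolP (lt u (a u) (a' u)); last first.
  rewrite big_pred0 // => v; apply/negP => /andP[vX gv].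
  by rewrite -(gain_at_entry vX gv) gv in nogain.
rewrite (big_pred1 u) => [|v]; last first.
  by apply/andP/eqP => [[]|->//]; apply: gain_at_entry.
rewrite leqNgt; apply/negP => small; case/negP: nC.
(* The edge g by which A' enters X yields a first loss; as the total loss is
   below w u, the triangle inequality rules out a second one. *)
have [||g gA /andP[tg hg]] :=
  connect_crossing (Z := mem (Some @: X))
    (arborescence_connect (x := Some u) A'_arb (in_setT _)).
- by apply/imsetP => -[].
- by rewrite mem_Some.
rewrite /= mem_Some in hg.
have gX : g \in entering X by rewrite inE hg.
have /andP[lg _] := entering_loss gain gA gX.
have sL : (head g \in X) && loss (head g) by rewrite hg.
apply: (@single_loss_condC (head g)) => // [|t tX lt_].
  by apply: leq_ltn_trans small; rewrite (bigD1 (head g)) //= leq_addr.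
apply: contraTeq small => tNs; rewrite -leqNgt.
rewrite (bigD1 (head g)) //= (bigD1 t) /=; last by rewrite tX lt_.
by rewrite addnA; apply/ltnW/(leq_trans (w_triangle (head g) t u))/leq_addr.
Qed.

End Comparison.

(** * Popularity *)

Lemma blockwise_sum (P Q : pred VG) :
    (forall X, X \in Xmax ->
       \sum_(v in X | P v) w v <= \sum_(v in X | Q v) w v) ->
  \sum_(v | P v) w v <= \sum_(v | Q v) w v.
Proof.
have split (S : pred VG) :
    \sum_(v | S v) w v = \sum_(X in Xmax) \sum_(v in X | S v) w v.
  rewrite (partition_big (pblock Xmax) (mem Xmax)) /=; last first.
    by move=> v _; case: (pblock_XmaxP v).
  apply: eq_bigr => X XM; apply: eq_bigl => v; rewrite andbC; congr (_ && _).
  apply/eqP/idP => [<-|]; [by case: (pblock_XmaxP v) | exact: pblock_XmaxE].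
by move=> le_PQ; rewrite !split; apply: leq_sum => X /le_PQ.
Qed.

End Algorithm.

Theorem theorem13 (VG EG : finType) (src tgt : EG -> VG)
    (loopless : forall a : EG, src a <> tgt a)
    (w : VG -> nat)
    (w_pos : forall v : VG, 0 < w v)
    (w_triangle : forall s t u : VG, w u < w s + w t)
    (le : VG -> rel (edge VG EG))
    (le_preorder : forall v : VG,
       total_preorder_on (entering src tgt [set v]) (le v))
    (root_least : forall (v : VG) (a : EG),
       tgt a = v -> lt le v (root_edge EG v) (inl a))
    (A : {set edge VG EG}) :
  algorithm_output src tgt w le (Some A) -> popular src tgt w le A.
Proof.
move=> outA; inversion outA as [| |At Av _ At_arb Av_arb AE]; subst A.
set A := At :|: _.
have arbA : r_arborescence src tgt A :=
  output_arborescence loopless At_arb Av_arb.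
split=> // -[A' arbA'].
rewrite /more_popular Order.TotalTheory.ltNge => /negP[].
rewrite Num.Theory.subr_le0.
rewrite -!(big_morph Posz PoszD (erefl (Posz 0))) lez_nat.
apply: (blockwise_sum (src := src) (tgt := tgt) (le := le)) => X XM.
have [u uX [u_dom a_safe]] :=
  output_safe loopless le_preorder At_arb Av_arb XM.
apply: (block_loss_ge_gain loopless le_preorder w_triangle arbA' _ XM uX
  u_dom a_safe) => v.
by case: (edge_intoP loopless v arbA).
Qed.
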